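(* Let $\Gamma=\langle\mathcal{A},\mathcal{R}\rangle$ be an AFRA which is an AF, i.e. $\mathcal{R}\subseteq\mathcal{A}\times\mathcal{A}$, and let $\mathcal{S}$ be the grounded extension of $\Gamma$. Then $\mathcal{S}=\mathcal{U}^{\rightarrow AFRA}$ where $\mathcal{U}$ is the D-grounded extension of $\Gamma$.
   Context: An AFRA (Argumentation Framework with Recursive Attacks) is a pair $\langle\mathcal{A},\mathcal{R}\rangle$ where $\mathcal{A}$ is a set (of arguments) and $\mathcal{R}$ is a set of attacks, each attack being a pair $\alpha=(A,X)$ with $A\in\mathcal{A}$ and ($X\in\mathcal{R}$ or $X\in\mathcal{A}$); $A=src(\alpha)$ is its source and $X=trg(\alpha)$ its target. Arguments and attacks are distinct objects ($\mathcal{A}\cap\mathcal{R}=\emptyset$). Defeat: for $\alpha\in\mathcal{R}$, $V\in\mathcal{A}\cup\mathcal{R}$, $\alpha$ directly defeats $V$ iff $V=trg(\alpha)$; $\alpha$ indirectly defeats $\beta\in\mathcal{R}$ iff $\alpha$ directly defeats $src(\beta)$; $\alpha\rightarrow_R V$ ($\alpha$ defeats $V$) iff $\alpha$ directly or indirectly defeats $V$. Only attacks can defeat. $W\in\mathcal{A}\cup\mathcal{R}$ is acceptable w.r.t. $\mathcal{S}\subseteq\mathcal{A}\cup\mathcal{R}$ iff for every $\alpha\in\mathcal{R}$ with $\alpha\rightarrow_R W$ there is $\beta\in\mathcal{S}$ with $\beta\rightarrow_R\alpha$. The characteristic function $\mathbb{F}_\Gamma:2^{\mathcal{A}\cup\mathcal{R}}\to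 2^{\mathcal{A}\cup\mathcal{R}}$ maps $\mathcal{S}$ to the set of all elements acceptable w.r.t. $\mathcal{S}$. The grounded extension of $\Gamma$ is the least (w.r.t. set inclusion) fixed point of $\mathbb{F}_\Gamma$. Dung notions (for $\Gamma$ viewed as a Dung argumentation framework with set of arguments $\mathcal{A}$ and attack relation $\mathcal{R}\subseteq\mathcal{A}\times\mathcal{A}$): $A\in\mathcal{A}$ is D-acceptable w.r.t. $\mathcal{U}\subseteq\mathcal{A}$ if for all $B\in\mathcal{A}$ with $(B,A)\in\mathcal{R}$ there is $C\in\mathcal{U}$ with $(C,B)\in\mathcal{R}$. The D-grounded extension is the least (w.r.t. set inclusion) fixed point of the function $2^{\mathcal{A}}\to 2^{\mathcal{A}}$ mapping $\mathcal{U}$ to $\{A\in\mathcal{A}\mid A\text{ is D-acceptable w.r.t. }\mathcal{U}\}$. For $\mathcal{U}\subseteq\mathcal{A}$, $\mathcal{U}^{\rightarrow AFRA}:=\mathcal{U}\cup\{\alpha\in\mathcal{R}\mid src(\alpha)\in\mathcal{U}\}$. *)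

(* Defs.v *)
From mathcomp Require Import all_boot.
From mathcomp Require Import boolp classical_sets.

Set Implicit Arguments.
Unset Strict Implicit.
Unset Printing Implicit Defensive.

Local Open Scope classical_set_scope.

(* Arguments are drawn from a carrier [T]; an attack is literally a pair
   (source, target), where the target is an argument or again an attack.  The
   two constructors keep arguments and attacks distinct. *)
Inductive elt (T : Type) : Type :=
| Arg of T
| Att of (T * elt T).

Arguments Arg {T} _.
Arguments Att {T} _.

Definition attack (T : Type) : Type := (T * elt T)%type.

Definition src {T : Type} (alpha : attack T) : T := alpha.1.
Definition trg {T : Type} (alpha : attack T) : elt T := alpha.2.

Record afra (T : Type) : Type := Afra {
  args : set T;
  atts : set (attack T);
  src_args : forall alpha, atts alpha -> args (src alpha);
  trg_elts : forall alpha, atts alpha ->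
    (Arg @` args `|` Att @` atts) (trg alpha)
}.

Section Afra.
Context {T : Type} (G : afra T).

Definition elts : set (elt T) := Arg @` args G `|` Att @` atts G.

Definition directly_defeats (alpha : attack T) (V : elt T) : Prop :=
  [/\ atts G alpha, elts V & V = trg alpha].

Definition indirectly_defeats (alpha beta : attack T) : Prop :=
  [/\ atts G alpha, atts G beta & directly_defeats alpha (Arg (src beta))].

Definition defeats (alpha : attack T) (V : elt T) : Prop :=
  directly_defeats alpha V \/
  exists2 beta, V = Att beta & indirectly_defeats alpha beta.

Definition acceptable (S : set (elt T)) (W : elt T) : Prop :=
  forall alpha, atts G alpha -> defeats alpha W ->
    exists2 beta, S (Att beta) & defeats beta (Att alpha).

Definition characteristic (S : set (elt T)) : set (elt T) :=
  [set W | elts W /\ acceptable S W].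

Definition D_acceptable (U : set T) (a : T) : Prop :=
  forall b, args G b -> atts G (b, Arg a) ->
    exists2 c, U c & atts G (c, Arg b).

Definition D_characteristic (U : set T) : set T :=
  [set a | args G a /\ D_acceptable U a].

Definition is_AF : Prop :=
  forall alpha, atts G alpha ->
    exists a b, [/\ args G a, args G b & alpha = (a, Arg b)].

Definition to_AFRA (U : set T) : set (elt T) :=
  Arg @` U `|` [set Att alpha | alpha in [set alpha | atts G alpha /\ U (src alpha)]].

End Afra.

(* Least fixed point of [F], seen as a map on the subsets of [D]. *)
Definition least_fixed_point {X : Type} (D : set X) (F : set X -> set X)
    (S : set X) : Prop :=
  [/\ S `<=` D, F S = S &
      forall S', S' `<=` D -> F S' = S' -> S `<=` S'].

Definition grounded {T : Type} (G : afra T) (S : set (elt T)) : Prop :=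
  least_fixed_point (elts G) (characteristic G) S.

Definition D_grounded {T : Type} (G : afra T) (U : set T) : Prop :=
  least_fixed_point (args G) (D_characteristic G) U.

(* Sanity checks: both extensions exist and are unique, so it is legitimate to
   speak of "the" grounded extension through the predicates above. *)
Lemma least_fixed_point_uniq {X : Type} (D : set X) (F : set X -> set X)
    (S1 S2 : set X) :
  least_fixed_point D F S1 -> least_fixed_point D F S2 -> S1 = S2.
Proof.
move=> [D1 F1 L1] [D2 F2 L2].
by apply/seteqP; split; [exact: L1|exact: L2].
Qed.

Lemma least_fixed_point_ex {X : Type} (D : set X) (F : set X -> set X) :
  (forall S, F S `<=` D) ->
  (forall S1 S2, S1 `<=` S2 -> F S1 `<=` F S2) ->
  exists S, least_fixed_point D F S.
Proof.
move=> FD Fmono; pose S := [set x | forall S', F S' `<=` S' -> S' x].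
have FS : F S `<=` S.
  by move=> x FSx S' FS'; apply: (FS'); apply: Fmono FSx => y; apply.
have SF : S `<=` F S by move=> x Sx; apply: Sx; exact: Fmono.
have FSE : F S = S by apply/seteqP.
exists S; split=> //; first by rewrite -FSE.
by move=> S' _ FS' x Sx; apply: Sx; rewrite FS'.
Qed.

Lemma grounded_ex {T : Type} (G : afra T) : exists S, grounded G S.
Proof.
apply: least_fixed_point_ex => [S W []//|S1 S2 S12 W [W_elt accW]].
split=> // alpha Ra /(accW _ Ra)[beta S1b db].
by exists beta => //; exact: S12.
Qed.

Lemma D_grounded_ex {T : Type} (G : afra T) : exists U, D_grounded G U.
Proof.
apply: least_fixed_point_ex => [U a []//|U1 U2 U12 a [a_arg acca]].
split=> // b Ab /(acca _ Ab)[c U1c Rcb].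
by exists c => //; exact: U12.
Qed.

(* Main.v *)
(** Over an AF every attack targets an argument, so an attack is defeated exactly
    when its source is: a set in the range of the characteristic function is
    therefore of the form [to_AFRA G V], with [V] its set of arguments.  As
    [to_AFRA] is injective, monotone, and intertwines [D_characteristic] with
    [characteristic], it is an order isomorphism between the fixed points of
    the two, hence maps the least one to the least one. *)
Require Import Defs.
From mathcomp Require Import all_boot.
From mathcomp Require Import boolp classical_sets.

Local Open Scope classical_set_scope.

Lemma defeats_Arg (T : Type) (G : afra T) (alpha : attack T) (a : T) :
  defeats G alpha (Arg a) <-> atts G alpha /\ trg alpha = Arg a.
Proof.
split=> [[[Ra _ ->]//|[beta //]]|[Ra ta]].
by left; split=> //; rewrite -ta; exact: trg_elts.
Qed.

(** Direct defeat of [Att beta] would need an attack whose target is an attack, which [is_AF] rules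
    out; only indirect defeat, through the source, remains. *)
Lemma defeats_Att (T : Type) (G : afra T) (alpha beta : attack T) :
  is_AF G -> atts G beta ->
  defeats G alpha (Att beta) <-> defeats G alpha (Arg (src beta)).
Proof.
move=> AF Rb; split=> [[[Ra _]|[_ [<-] [_ _ ?]]]|/defeats_Arg[Ra ta]].
- by have [a [b [_ _ ->]]] := AF _ Ra.
- by left.
- right; exists beta => //; split=> //.
  by split=> //; rewrite -ta; exact: trg_elts.
Qed.

Lemma acceptable_Att (T : Type) (G : afra T) (S : set (elt T)) (beta : attack T) :
  is_AF G -> atts G beta ->
  acceptable G S (Att beta) <-> acceptable G S (Arg (src beta)).
Proof.
move=> AF Rb.
by split=> acc alpha Ra dab; apply: acc => //; apply/(defeats_Att _ _ _ _ AF Rb).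
Qed.

Lemma to_AFRA_Arg (T : Type) (G : afra T) (U : set T) (a : T) :
  to_AFRA G U (Arg a) <-> U a.
Proof.
by split=> [[[_ ? [<-]]|[]]|Ua] //; left; exists a.
Qed.

Lemma to_AFRA_Att (T : Type) (G : afra T) (U : set T) (alpha : attack T) :
  to_AFRA G U (Att alpha) <-> atts G alpha /\ U (src alpha).
Proof.
by split=> [[[]|[_ ? [<-]]]|?] //; right; exists alpha.
Qed.

Lemma to_AFRA_inj (T : Type) (G : afra T) : injective (to_AFRA G).
Proof.
move=> U V UV; apply/seteqP; split=> a /(to_AFRA_Arg _ G).
  by rewrite UV => /to_AFRA_Arg.
by rewrite -UV => /to_AFRA_Arg.
Qed.

Lemma to_AFRA_subset (T : Type) (G : afra T) (U V : set T) :
  U `<=` V -> to_AFRA G U `<=` to_AFRA G V.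
Proof.
move=> UV [a /to_AFRA_Arg Ua|alpha /to_AFRA_Att[Ra Ua]].
  by apply/to_AFRA_Arg; exact: UV.
by apply/to_AFRA_Att; split=> //; exact: UV.
Qed.

Lemma to_AFRA_elts (T : Type) (G : afra T) (U : set T) :
  U `<=` args G -> to_AFRA G U `<=` elts G.
Proof.
move=> UA [a /to_AFRA_Arg Ua|alpha /to_AFRA_Att[Ra _]].
  by left; exists a => //; exact: UA.
by right; exists alpha.
Qed.

Lemma characteristic_Arg (T : Type) (G : afra T) (S : set (elt T)) (a : T) :
  characteristic G S (Arg a) <-> args G a /\ acceptable G S (Arg a).
Proof.
by split=> [[[[_ ? [<-]]|[]]]|[]] //; split=> //; left; exists a.
Qed.

Lemma characteristic_Att (T : Type) (G : afra T) (S : set (elt T))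
    (alpha : attack T) : is_AF G ->
  characteristic G S (Att alpha) <->
  atts G alpha /\ characteristic G S (Arg (src alpha)).
Proof.
move=> AF; split=> [[[[]//|[beta Ra [<-]]] acc]|[Ra]].
  split=> //; apply/characteristic_Arg; split; first exact: src_args.
  exact/(acceptable_Att _ _ _ _ AF Ra).
move=> /characteristic_Arg[_ acc]; split; first by right; exists alpha.
exact/(acceptable_Att _ _ _ _ AF Ra).
Qed.

(** [S] is arbitrary here, so every fixed point of [characteristic G] lies in the range of
    [to_AFRA G]. *)
Lemma characteristic_to_AFRA_Arg (T : Type) (G : afra T) (S : set (elt T)) :
  is_AF G -> characteristic G S = to_AFRA G (Arg @^-1` characteristic G S).
Proof.
move=> AF; apply/seteqP; split=> -[a|alpha].
- by move=> Fa; apply/to_AFRA_Arg.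
- by move=> /(characteristic_Att _ _ _ _ AF) Fa; apply/to_AFRA_Att.
- by move=> /to_AFRA_Arg.
- by move=> /to_AFRA_Att Fa; apply/(characteristic_Att _ _ _ _ AF).
Qed.

(** A defending attack in [to_AFRA G U] has its source in [U] and must hit the source of the attack
    it defeats, which is exactly a Dung counterattack from [U]. *)
Lemma acceptable_to_AFRA (T : Type) (G : afra T) (U : set T) (a : T) :
  is_AF G -> acceptable G (to_AFRA G U) (Arg a) <-> D_acceptable G U a.
Proof.
move=> AF; split=> acc.
  move=> b Ab Rba.
  have [|[c x] /to_AFRA_Att[Rc Uc]] := acc _ Rba; first exact/defeats_Arg.
  move=> /(defeats_Att _ _ _ _ AF Rba)/defeats_Arg[_] xb.
  (* Folding [x] back into [trg (c, x)] lets [xb] identify it with [Arg b]. *)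
  by exists c => //; move: Rc; rewrite -[x]/(trg (c, x)) xb.
move=> [b x] Rb /defeats_Arg[_ xa]; rewrite /trg /= in xa; subst x.
have [c Uc Rc] := acc _ (src_args Rb) Rb.
exists (c, Arg b); first exact/to_AFRA_Att.
by apply/(defeats_Att _ _ _ _ AF Rb)/defeats_Arg.
Qed.

Lemma characteristic_to_AFRA (T : Type) (G : afra T) (U : set T) :
  is_AF G -> characteristic G (to_AFRA G U) = to_AFRA G (D_characteristic G U).
Proof.
move=> AF; rewrite characteristic_to_AFRA_Arg //; congr to_AFRA.
apply/seteqP; split=> a.
  by move=> /characteristic_Arg[Aa /(acceptable_to_AFRA _ _ _ _ AF)].
by move=> [Aa /(acceptable_to_AFRA _ _ _ _ AF) acc]; apply/characteristic_Arg.
Qed.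

Theorem proposition8 (T : Type) (G : afra T) (S : set (elt T)) (U : set T)
    (G_AF : is_AF G) (S_grounded : grounded G S) (U_grounded : D_grounded G U) :
  S = to_AFRA G U.
Proof.
case: S_grounded U_grounded => _ FS S_least [UA FU U_least].
apply/seteqP; split.
  (* [to_AFRA G U] is itself a fixed point, so it contains the least one. *)
  apply: S_least; first exact: to_AFRA_elts.
  by rewrite characteristic_to_AFRA // FU.
pose V := Arg @^-1` S.
have SV : S = to_AFRA G V.
  by rewrite -FS [LHS]characteristic_to_AFRA_Arg // /V FS.
(* The fixed-point equation of [S] is pulled back along the injective [to_AFRA G]. *)
have FV : D_characteristic G V = V.
  by apply: (to_AFRA_inj _ G); rewrite -characteristic_to_AFRA // -SV.
rewrite SV; apply: to_AFRA_subset; apply: U_least => //.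
(* [V] consists of arguments of [G], being a value of [D_characteristic G]. *)
by rewrite -FV => a [].
Qed.
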